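(* Let $K$ be a finite simplicial complex which is vertex-homogeneous and non-evasive. Then the core of $K$ is non-evasive.
   Context: All simplicial complexes are finite (simplices are nonempty finite sets of vertices). A complex $K$ is vertex-homogeneous if for any two vertices $v,w\in K$ there is a simplicial automorphism $\varphi:K\to K$ with $\varphi(v)=w$. For a vertex $v$ of a complex $K$, the link $\mathrm{lk}_K(v)$ is the subcomplex of simplices $\tau\in K$ with $v\notin\tau$ and $\tau\cup\{v\}\in K$, and $K\smallsetminus v$ is the full subcomplex of $K$ spanned by the vertices different from $v$. A simplicial cone is a complex $aM$, the join of a (possibly empty) complex $M$ and a vertex $a$ not in $M$; its simplices are $\{a\}$, the simplices $\tau$ of $M$, and the sets $\{a\}\cup\tau$ with $\tau\in M$. A vertex $v$ of $K$ is dominated if $\mathrm{lk}_K(v)$ is a simplicial cone; in that case there is an elementary strong collapse from $K$ to $K\smallsetminus v$. A strong collapse from $K$ to a subcomplex $L$ is a finite (possibly empty) sequence of elementary strong collapses starting in $K$ and ending in $L$. A complex is minimal if it has no dominated vertices. A core of $K$ is a subcomplex $K_0\subseteq K$ which is a minimal complex and such that $K$ strong collapses to $K_0$; every complex has a core and it is unique up to isomorphism, so one speaks of the core of $K$. A complex $K$ is non-evasive if it has only one vertex or, inductively, if there is a vertex $v\in K$ such that both $K\smallsetminus v$ and $\mathrm{lk}_K(v)$ are non-evasive. *)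

(* Defs.v *)
From mathcomp Require Import all_boot.

Set Implicit Arguments.
Unset Strict Implicit.
Unset Printing Implicit Defensive.

(* A finite simplicial complex is given by its set of simplices, over an
   ambient finite type T of potential vertices: elements of T need not be
   vertices, so that subcomplexes live over the same T. The empty complex is
   allowed; the empty set is never a simplex. *)

Section Complexes.

Variable T : finType.
Implicit Types (K L M : {set {set T}}) (s t : {set T}) (a v w : T).

Definition is_complex K : bool :=
  (set0 \notin K) &&
  [forall s in K, forall t : {set T}, (t != set0) && (t \subset s) ==> (t \in K)].

Definition vertices K : {set T} := [set v | [set v] \in K].

Definition simplicial K L (f : T -> T) : Prop :=
  forall s, s \in K -> f @: s \in L.

(* Only the values of f on the vertices of K matter. *)
Definition automorphism K (f : T -> T) : Prop :=
  simplicial K K f /\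
  exists g : T -> T,
    [/\ simplicial K K g, {in vertices K, cancel f g}
      & {in vertices K, cancel g f}].

Definition vertex_homogeneous K : Prop :=
  forall v w, v \in vertices K -> w \in vertices K ->
    exists f : T -> T, automorphism K f /\ f v = w.

Definition link K v : {set {set T}} :=
  [set t in K | (v \notin t) && (v |: t \in K)].

Definition deletion K v : {set {set T}} := [set t in K | v \notin t].

Definition cone a M : {set {set T}} :=
  [set a] |: (M :|: [set a |: t | t in M]).

Definition is_cone L : bool :=
  [exists a : T, exists M : {set {set T}},
    [&& is_complex M, a \notin vertices M & L == cone a M]].

Definition dominated K v : bool := (v \in vertices K) && is_cone (link K v).

Inductive strong_collapse : {set {set T}} -> {set {set T}} -> Prop :=
| strong_collapse_refl K : strong_collapse K K
| strong_collapse_step K L v :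
    dominated K v -> strong_collapse (deletion K v) L -> strong_collapse K L.

Definition minimal K : Prop := forall v, ~~ dominated K v.

Definition is_core K K0 : Prop :=
  [/\ is_complex K0, K0 \subset K, minimal K0 & strong_collapse K K0].

Inductive nonevasive : {set {set T}} -> Prop :=
| nonevasive_vertex K : #|vertices K| = 1 -> nonevasive K
| nonevasive_step K v :
    v \in vertices K -> nonevasive (deletion K v) -> nonevasive (link K v) ->
    nonevasive K.

Lemma is_complexP K :
  reflect (set0 \notin K /\
           forall s t, s \in K -> t != set0 -> t \subset s -> t \in K)
          (is_complex K).
Proof.
apply: (iffP andP) => -[K0 Kcl]; split=> //.
  by move=> s t Ks t0 ts; move/forall_inP/(_ s Ks)/forallP/(_ t): Kcl; rewrite t0 ts.
apply/forall_inP=> s Ks; apply/forallP=> t; apply/implyP=> /andP[t0 ts].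
exact: Kcl Ks t0 ts.
Qed.

Lemma deletion_complex K v : is_complex K -> is_complex (deletion K v).
Proof.
move=> /is_complexP[K0 Kcl]; apply/is_complexP; split.
  by rewrite inE (negbTE K0).
move=> s t; rewrite !inE => /andP[Ks vs] t0 ts.
by rewrite (Kcl s t) //=; apply: contra vs; apply: (subsetP ts).
Qed.

Lemma link_complex K v : is_complex K -> is_complex (link K v).
Proof.
move=> /is_complexP[K0 Kcl]; apply/is_complexP; split.
  by rewrite inE (negbTE K0).
move=> s t; rewrite !inE => /and3P[Ks vs Kvs] t0 ts.
rewrite (Kcl s t) //=; apply/andP; split.
  by apply: contra vs; apply: (subsetP ts).
apply: Kcl Kvs _ (setUS _ ts).
by apply/set0Pn; exists v; rewrite !inE eqxx.
Qed.

Lemma core_exists K : is_complex K -> exists K0, is_core K K0.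
Proof.
have [n] := ubnP #|K|; elim: n K => // n IHn K ltKn Kc.
have [v domv | min] := pickP (dominated K); last first.
  exists K; split=> //; last exact: strong_collapse_refl.
  by move=> v; rewrite min.
have sDK : deletion K v \proper K.
  apply/properP; split; first by apply/subsetP=> t; rewrite inE => /andP[].
  case/andP: (domv); rewrite inE => Kv _; exists [set v] => //.
  by rewrite !inE eqxx andbF.
have [||K0 [K0c sK0 minK0 colK0]] := IHn (deletion K v).
- exact: leq_trans (proper_card sDK) _.
- exact: deletion_complex.
exists K0; split=> //; first exact: subset_trans sK0 (proper_sub sDK).
exact: strong_collapse_step domv colK0.
Qed.

End Complexes.

(* Main.v *)
Require Import Defs.
From mathcomp Require Import all_boot.
From mathcomp Require Import perm.

(** The closed star of a dominated vertex is contained in that of any dominating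
    vertex; in a vertex-homogeneous complex all closed stars have the same
    cardinality, so the two stars are equal and the vertices are "twins".
    Deleting one of two twins preserves the property that every dominated
    vertex is a twin of the vertex dominating it, and it preserves
    non-evasiveness: by induction, if the first vertex removed is neither twin,
    they remain twins in its deletion and its link, while if it is one of them,
    the deletion of the other is an isomorphic complex. Hence every complex
    along a strong collapse to the core is non-evasive. *)

Set Implicit Arguments.
Unset Strict Implicit.
Unset Printing Implicit Defensive.

Section Twins.

Variable T : finType.
Implicit Types (K L : {set {set T}}) (s t : {set T}) (a u v w x y : T).
Implicit Type p : {perm T}.

(** The closed star. In a complex it is empty unless [v] is a vertex. *)
Definition star K v : {set {set T}} := [set s in K | v |: s \in K].

(** Permuting the whole of [T] makes relabelling injective on all sets; exchanging two twins is then
    the transposition [tperm v w]. *)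
Definition relabel (p : {perm T}) K : {set {set T}} :=
  [set p @: s | s : {set T} in K].

Lemma complex_sub K s t :
  is_complex K -> s \in K -> t != set0 -> t \subset s -> t \in K.
Proof. by move=> /is_complexP[_]; apply. Qed.

Lemma complex_subU1 K s t v :
  is_complex K -> s \in K -> v |: t \subset s -> v |: t \in K.
Proof.
move=> Kc Ks; apply: (complex_sub Kc Ks) => //.
by apply/set0Pn; exists v; rewrite setU11.
Qed.

Lemma mem_vertices K s v :
  is_complex K -> s \in K -> v \in s -> v \in vertices K.
Proof.
move=> Kc Ks vs; rewrite inE; apply: complex_sub Kc Ks _ _.
  by apply/set0Pn; exists v; rewrite set11.
by rewrite sub1set.
Qed.

Lemma mem_relabel p K s : (p @: s \in relabel p K) = (s \in K).
Proof. by rewrite mem_imset //; apply/imset_inj/perm_inj. Qed.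

Lemma eq_relabel p K L :
  (forall s, (p @: s \in L) = (s \in K)) -> relabel p K = L.
Proof.
move=> KL; apply/setP=> s.
have -> : s = p @: (p^-1%g @: s).
  by rewrite -imset_comp (eq_imset (g := id)) ?imset_id // => x /=; rewrite permKV.
by rewrite mem_relabel KL.
Qed.

Lemma vertices_relabel p K : vertices (relabel p K) = p @: vertices K.
Proof.
apply/setP=> v; rewrite -[v](permKV p) mem_imset ?inE; last exact: perm_inj.
by rewrite -imset_set1 mem_relabel.
Qed.

Lemma deletion_relabel p K v :
  relabel p (deletion K v) = deletion (relabel p K) (p v).
Proof.
apply: eq_relabel => s.
by rewrite !inE mem_relabel mem_imset //; apply: perm_inj.
Qed.

Lemma link_relabel p K v : relabel p (link K v) = link (relabel p K) (p v).
Proof.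
apply: eq_relabel => s.
by rewrite !inE -imsetU1 !mem_relabel mem_imset //; apply: perm_inj.
Qed.

Lemma nonevasive_relabel p K : nonevasive K -> nonevasive (relabel p K).
Proof.
elim=> {K} [K K1 | K v Kv _ IHd _ IHl].
  apply: nonevasive_vertex; rewrite vertices_relabel card_imset //.
  exact: perm_inj.
apply: (@nonevasive_step _ _ (p v)).
- by rewrite vertices_relabel mem_imset //; apply: perm_inj.
- by rewrite -deletion_relabel.
- by rewrite -link_relabel.
Qed.

(** * Deletions, links and stars *)

Lemma deletionC K u v : deletion (deletion K u) v = deletion (deletion K v) u.
Proof. by apply/setP=> s; rewrite !inE andbAC. Qed.

Lemma link_deletion K u v :
  u != v -> link (deletion K v) u = deletion (link K u) v.
Proof.
move=> uv; apply/setP=> s; rewrite !inE negb_or eq_sym uv /=.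
by case: (s \in K) (u \in s) (v \in s) (u |: s \in K) => [] [] [] [].
Qed.

Lemma deletion_nonvertex K v :
  is_complex K -> v \notin vertices K -> deletion K v = K.
Proof.
move=> Kc vK; apply/setP=> s; rewrite inE.
by case Ks: (s \in K) => //=; apply: contra vK; apply: mem_vertices.
Qed.

Lemma star_deletion K u v :
  u != v -> star (deletion K u) v = deletion (star K v) u.
Proof.
move=> uv; apply/setP=> s; rewrite !inE (negbTE uv) /=.
by case: (s \in K) (u \in s) (v |: s \in K) => [] [] [].
Qed.

(** On the right [v] enters only through [star K v], so twins of [K] other than [u] stay twins in
    the link of [u]. *)
Lemma star_link K u v :
  is_complex K -> u != v ->
  star (link K u) v = [set s in link K u | u |: s \in star K v].
Proof.
move=> Kc uv; apply/setP=> s; rewrite !inE (negbTE uv) /= (setUCA [set v]).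
case: (s \in K) (u \in s) (u |: s \in K) => [] [] [] //=.
have [/(complex_subU1 (t := s) (v := v) Kc)-> // | _] := boolP (u |: (v |: s) \in K).
  exact: subsetUr.
by rewrite andbF.
Qed.

Lemma vertex_star K v : (v \in vertices K) = ([set v] \in star K v).
Proof. by rewrite !inE setUid andbb. Qed.

(** * Twin vertices *)

Lemma mem_setU1_twins K v w s :
  star K v = star K w -> s \in K -> (v |: s \in K) = (w |: s \in K).
Proof. by move=> + Ks => /setP/(_ s); rewrite !inE Ks. Qed.

(** If [s] contains one of the twins, adjoining the other still gives a simplex, and the image of
    [s] is a face of it. If [s] contains neither, it is fixed. *)
Lemma mem_tperm_twins K v w s :
  is_complex K -> star K v = star K w -> s \in K -> tperm v w @: s \in K.
Proof.
move=> Kc vw Ks; have s0: s != set0.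
  by apply: contraTneq Ks => ->; case/is_complexP: Kc.
have im0: tperm v w @: s != set0.
  by case/set0Pn: s0 => x xs; apply/set0Pn; exists (tperm v w x); apply: imset_f.
have sub: tperm v w @: s \subset v |: (w |: s).
  apply/subsetP=> _ /imsetP[z zs ->]; rewrite !inE.
  by case: tpermP => *; rewrite ?eqxx ?orbT // zs !orbT.
have [vs | vs] := boolP (v \in s).
  have Kws: w |: s \in K by rewrite -(mem_setU1_twins vw) // (setUidPr _) // sub1set.
  apply: complex_sub Kc Kws im0 (subset_trans sub _).
  by rewrite subUset subxx sub1set !inE vs orbT.
have [ws | ws] := boolP (w \in s).
  have Kvs: v |: s \in K by rewrite (mem_setU1_twins vw) // (setUidPr _) // sub1set.
  apply: complex_sub Kc Kvs im0 (subset_trans sub _).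
  by rewrite !subUset !sub1set !inE eqxx ws subsetUr orbT.
suff -> : tperm v w @: s = s by [].
rewrite -[RHS]imset_id; apply: eq_in_imset => x xs.
by rewrite tpermD //; apply: contraTneq xs => <-.
Qed.

Lemma deletion_twins K v w :
  is_complex K -> star K v = star K w ->
  relabel (tperm v w) (deletion K v) = deletion K w.
Proof.
move=> Kc vw; apply: eq_relabel => s.
rewrite !inE -{2}(tpermL v w) (mem_imset _ _ perm_inj); congr (_ && _).
apply/idP/idP => [Ks | ]; last exact: mem_tperm_twins.
have -> : s = tperm v w @: (tperm v w @: s).
  by rewrite -imset_comp (eq_imset (g := id)) ?imset_id // => x /=; rewrite tpermK.
exact: mem_tperm_twins.
Qed.

Lemma nonevasive_deletion_twin K v w :
  nonevasive K -> is_complex K -> v \in vertices K -> v != w ->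
  star K v = star K w -> nonevasive (deletion K v).
Proof.
move=> Kne; elim: Kne v w => {K} [K K1 | K u Ku Kdu IHd Klu IHl] v w Kc Kv vw Svw.
  have Kw: w \in vertices K.
    move: Kv; rewrite vertex_star Svw => /setIdP[_ Kwv].
    exact: mem_vertices Kc Kwv (setU11 _ _).
  have: #|[set v; w]| <= #|vertices K|.
    by apply/subset_leq_card/subsetP=> x /set2P[]->.
  by rewrite K1 cards2 vw.
have [<- // | uv] := eqVneq u v.
have [uw | uw] := eqVneq u w.
  by rewrite -(@deletion_twins _ w v) //; apply: nonevasive_relabel; rewrite -uw.
apply: (@nonevasive_step _ _ u).
- by move: Ku; rewrite !inE => ->; rewrite eq_sym.
- rewrite deletionC; apply: (IHd v w) => //.
  + exact: deletion_complex.
  + by move: Kv; rewrite !inE uv => ->.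
  + by rewrite !star_deletion ?Svw.
rewrite link_deletion //; have Lc := link_complex u Kc.
(* Outside the link of [u], the vertex [v] can be deleted without effect, and the link is
   non-evasive by assumption. *)
have [Lv | Lv] := boolP (v \in vertices (link K u)); last first.
  by rewrite deletion_nonvertex.
by apply: (IHl v w) => //; rewrite !star_link ?Svw.
Qed.

(** * Dominated vertices and their stars *)

(** The apex of the cone serves as [a]: adjoining it to a simplex of the link stays in the link, and
    [v] can then be put back. *)
Lemma dominated_star_sub K v :
  is_complex K -> dominated K v ->
  v \in vertices K /\ exists2 a, v != a & star K v \subset star K a.
Proof.
move=> Kc /andP[Kv /existsP[a /existsP[M /and3P[_ _ /eqP lkE]]]]; split=> //.
have: [set a] \in link K v by rewrite lkE !inE eqxx.
rewrite !inE => /and3P[_ va Kva]; exists a => //.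
apply/subsetP=> s; rewrite !inE => /andP[Ks Kvs]; rewrite Ks /=.
(* The empty set is not in the link; in that case [s] lies in [[set v]], and the edge joining [v]
   and [a] suffices. *)
have [s0 | s0] := eqVneq (s :\ v) set0.
  apply: complex_subU1 Kc Kva _; rewrite subUset subsetUr /=.
  by rewrite (subset_trans _ (subsetUl _ _)) // -setD_eq0 s0.
have lks: s :\ v \in link K v.
  rewrite !inE eqxx (complex_sub Kc Ks s0) ?subD1set //=.
  by apply: complex_subU1 Kc Kvs _; rewrite setUS ?subD1set.
have: a |: (s :\ v) \in link K v.
  move: lks; rewrite lkE !inE => /or3P[/eqP-> | Ms | /imsetP[t Mt ->]].
  - by rewrite setUid eqxx.
  - by rewrite imset_f ?orbT.
  - by rewrite setUA setUid imset_f ?orbT.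
rewrite !inE => /and3P[_ _ Kall]; apply: complex_subU1 Kc Kall _.
apply/subsetP=> x; rewrite !inE => /orP[->|->]; first by rewrite orbT.
by case: (x == v); rewrite ?orbT.
Qed.

(** The invariant of the collapse: vertex-homogeneity implies it, but need not itself survive the
    deletion of a dominated vertex. *)
Definition dominated_are_twins K :=
  forall v a, v \in vertices K -> v != a -> star K v \subset star K a ->
  star K v = star K a.

(** Taking images under [f] sends one star into the other, injectively because [g] inverts [f] on
    vertices. *)
Lemma leq_card_star K f v :
  is_complex K -> automorphism K f -> #|star K v| <= #|star K (f v)|.
Proof.
move=> Kc [fK [g [_ fg _]]].
rewrite -(card_in_imset (f := fun s => f @: s) (D := star K v)); last first.
  apply: (can_in_inj (g := fun s => g @: s)) => s; rewrite inE => /andP[Ks _].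
  rewrite -imset_comp -[RHS]imset_id; apply: eq_in_imset => x xs /=.
  exact/fg/(mem_vertices Kc Ks).
apply/subset_leq_card/subsetP=> _ /imsetP[s + ->].
by rewrite !inE -imsetU1 => /andP[/fK-> /fK->].
Qed.

Lemma homogeneous_dominated_are_twins K :
  is_complex K -> vertex_homogeneous K -> dominated_are_twins K.
Proof.
move=> Kc Kh v a Kv va Sva; apply/eqP; rewrite eqEcard Sva /=.
have Ka: a \in vertices K.
  move: Kv; rewrite vertex_star => /(subsetP Sva)/setIdP[_ Kav].
  exact: mem_vertices Kc Kav (setU11 _ _).
(* The automorphism carries the larger star, that of [a], back into the star of [v]. *)
by have [f [fK <-]] := Kh _ _ Ka Kv; apply: leq_card_star.
Qed.

(** An inclusion of stars in the deletion lifts to [K], where it is an equality, which then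
    restricts to the deletion again. *)
Lemma dominated_are_twins_deletion K v a :
  is_complex K -> v != a -> star K v = star K a ->
  dominated_are_twins K -> dominated_are_twins (deletion K v).
Proof.
move=> Kc va Sva Kt x y; rewrite !inE => /andP[Kx vx] xy Sxy.
(* The inclusion applied to [[set x]] makes [y] a vertex of the deletion. *)
have vy : v != y.
  have: [set x] \in star (deletion K v) x by rewrite -vertex_star !inE Kx.
  by move/(subsetP Sxy)/setIdP=> [_]; rewrite !inE negb_or => /and3P[].
rewrite !star_deletion //; congr (deletion _ _).
apply: Kt => //; first by rewrite inE.
apply/subsetP=> s /[!inE] /andP[Ks Kxs]; rewrite Ks /=.
have [vs | vs] := boolP (v \in s); last first.
  have: s \in star (deletion K v) x by rewrite !inE Ks Kxs negb_or vx vs.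
  by move/(subsetP Sxy); rewrite !inE => /and3P[_].
have Kaxs: a |: (x |: s) \in K.
  by rewrite -(mem_setU1_twins Sva) // (setUidPr _) // sub1set !inE vs orbT.
(* As [a] is a twin of [v], replacing [v] by [a] tests [s] inside the deletion. *)
pose t := a |: (s :\ v).
have: t \in star (deletion K v) x.
  rewrite !inE !negb_or vx va eqxx /= !andbT.
  have st: t \subset a |: (x |: s).
    by rewrite setUS // (subset_trans (subD1set _ _)) // subsetUr.
  rewrite (complex_subU1 Kc Kaxs) // (complex_subU1 Kc Kaxs) //.
  by rewrite subUset st sub1set !inE eqxx orbT.
move/(subsetP Sxy); rewrite !inE => /and3P[_ Kyt _].
(* Since [a] belongs to [t], its twin [v] can be adjoined; [y |: s] is a face of the result. *)
have Kvyt: v |: (y |: t) \in K.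
  by rewrite (mem_setU1_twins Sva) // (setUidPr _) // sub1set !inE eqxx orbT.
apply: complex_subU1 Kc Kvyt _.
apply/subsetP=> z; rewrite !inE => /orP[->|->]; first by rewrite orbT.
by case: (z == v); rewrite ?orbT.
Qed.

Lemma strong_collapse_nonevasive K L :
  strong_collapse K L -> is_complex K -> dominated_are_twins K ->
  nonevasive K -> nonevasive L.
Proof.
elim=> {K L} // K L v domv _ IH Kc Kt Kne.
have [Kv [a va Sva]] := dominated_star_sub Kc domv.
have {}Sva := Kt v a Kv va Sva.
apply: IH; first exact: deletion_complex.
  exact: dominated_are_twins_deletion Kc va Sva Kt.
exact: nonevasive_deletion_twin Kne Kc Kv va Sva.
Qed.

End Twins.

Theorem corollary6p13 (T : finType) (K : {set {set T}})
    (Kcomplex : is_complex K)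
    (Khomog : vertex_homogeneous K)
    (Knonev : nonevasive K) :
  forall K0 : {set {set T}}, is_core K K0 -> nonevasive K0.
Proof.
move=> K0 [_ _ _ colK]; apply: strong_collapse_nonevasive colK _ _ _ => //.
exact: homogeneous_dominated_are_twins.
Qed.
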